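(* Let $q\in[2,\infty)$, let $X,E$ be Banach spaces and let $f\in\mathrm{Lip}_0(X,E)$. The following assertions are equivalent: (i) $f\in\mathcal{C}_q^{\mathrm{Lip}_0}(X,E)$, i.e. $f$ has cotype $q$. (ii) $\hat f\in\mathrm{Lip}_0(\mathrm{RAD}(X),\ell_q(E))$. (iii) $\hat f\in\mathrm{Lip}_0(\mathrm{Rad}(X),\ell_q(E))$. Furthermore (when these hold), $\mathrm{Lip}(\hat f:\mathrm{RAD}(X)\to\ell_q(E))=\mathrm{Lip}(\hat f:\mathrm{Rad}(X)\to\ell_q(E))=\|f\|_{\mathcal{C}_q^{\mathrm{Lip}}}$.
   Context: For Banach spaces $X,E$, $\mathrm{Lip}_0(X,E)$ is the Banach space of Lipschitz maps $f:X\to E$ with $f(0)=0$, normed by $\mathrm{Lip}(f)=\sup_{x\ne y}\|f(x)-f(y)\|/\|x-y\|$. For $f\in \mathrm{Lip}_0(X,E)$, $\hat f$ denotes the coordinatewise map $\hat f((x_n)_n)=(f(x_n))_n$; writing $\hat f\in\mathrm{Lip}_0(A,B)$ for sequence spaces $A\subseteq X^{\mathbb{N}}$, $B\subseteq E^{\mathbb{N}}$ means that $\hat f$ maps $A$ into $B$ and is Lipschitz. $(r_n)_{n\in\mathbb{N}}$ are the Rademacher functions on $[0,1]$. $\ell_q(E)$ is the space of $E$-valued sequences with $\|(x_n)_n\|_{\ell_q(E)}=(\sum_n\|x_n\|^q)^{1/q}<\infty$. $\mathrm{Rad}(X)$ is the space of sequences $(x_n)_n\in X^{\mathbb{N}}$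 such that $\sum_n r_n x_n$ converges in $L_s([0,1],X)$ for all $s\in(0,\infty)$, with norm $\|(x_n)_n\|_{\mathrm{Rad}(X)}=\left(\int_0^1\|\sum_{i=1}^\infty r_i(t)x_i\|_X^2\,dt\right)^{1/2}$. $\mathrm{RAD}(X)$ is the space of sequences $(x_n)_n\in X^{\mathbb{N}}$ with $\|(x_n)_n\|_{\mathrm{RAD}(X)}=\sup_N\|(x_1,\ldots,x_N,0,0,\ldots)\|_{\mathrm{Rad}(X)}<\infty$. $f\in\mathrm{Lip}_0(X,E)$ has cotype $q$ if there is $K>0$ such that for all $N\in\mathbb{N}$, $(\lambda_1,\ldots,\lambda_N)\in\mathbb{R}^N$ and $(x_1,\ldots,x_N),(y_1,\ldots,y_N)\in X^N$, $$\left(\sum_{k=1}^N|\lambda_k|^q\|f(x_k)-f(y_k)\|_E^q\right)^{1/q}\le K\left(\int_0^1\Big\|\sum_{k=1}^N\lambda_k r_k(t)(x_k-y_k)\Big\|_X^2dt\right)^{1/2}.$$ The set of such $f$ is $\mathcal{C}_q^{\mathrm{Lip}_0}(X,E)$ and $\|f\|_{\mathcal{C}_q^{\mathrm{Lip}}}$ is the infimum of all such $K$. *)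

(* Defs.v *)
From HB Require Import structures.
From mathcomp Require Import all_boot all_order all_algebra.
From mathcomp Require Import all_classical all_reals all_analysis.
Import Order.TTheory GRing.Theory Num.Theory.
Import numFieldNormedType.Exports.

Set Implicit Arguments.
Unset Strict Implicit.
Unset Printing Implicit Defensive.

Local Open Scope classical_set_scope.
Local Open Scope ring_scope.

(* Sequences are indexed from 0, so the term [x i] of a sequence and
   [rademacher i] correspond to x_(i+1) and r_(i+1) in the 1-based notation;
   [rademacher i] has 2 ^ i periods on [0, 1]. *)
Definition rademacher (R : realType) (i : nat) (t : R) : R :=
  Num.sg (sin (2 ^+ i.+1 * pi * t)).

Definition Lip0 (R : realType) (X E : normedModType R) : set (X -> E) :=
  [set f | f 0 = 0 /\ lipschitz f].

(* A space of V-valued sequences: the set of its elements, and its norm, which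
   is only meaningful on that set. *)
Record seq_space (R : realType) (V : normedModType R) := SeqSpace {
  seq_in : set (nat -> V) ;
  seq_norm : (nat -> V) -> \bar R
}.

Section SequenceMaps.
Context {R : realType} {X E : normedModType R}.
Implicit Types (A : seq_space X) (B : seq_space E).

Definition seq_Lip0 A B : set ((nat -> X) -> (nat -> E)) :=
  [set g | [/\ forall x, seq_in A x -> seq_in B (g x),
               g 0 = 0 &
               exists2 K : R, 0 <= K &
                 forall x y, seq_in A x -> seq_in A y ->
                   (seq_norm B (g x - g y)%R <= K%:E * seq_norm A (x - y)%R)%E]].

(* The supremum is taken in R, so it is 0 when A is the zero space; it is the
   Lipschitz constant of the elements of [seq_Lip0 A B]. *)
Definition seq_Lip A B (g : (nat -> X) -> (nat -> E)) : R :=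
  sup [set r | exists x y, [/\ seq_in A x, seq_in A y, x <> y &
    r = fine (seq_norm B (g x - g y)) / fine (seq_norm A (x - y))]].

Definition hat (f : X -> E) (x : nat -> X) : nat -> E := fun n => f (x n).

End SequenceMaps.

Section Spaces.
Context {R : realType}.
Local Notation mu := (@lebesgue_measure R).

Definition lq_norm (V : normedModType R) (q : R) (x : nat -> V) : \bar R :=
  ((\sum_(0 <= n <oo) (`|x n| `^ q)%R%:E) `^ (q^-1)%R)%E.

Definition lq (V : normedModType R) (q : R) : seq_space V :=
  SeqSpace [set x | (lq_norm q x < +oo)%E] (lq_norm q).

(* Bochner measurability on [0, 1]. *)
Definition simple_map (V : normedModType R) (g : R -> V) : Prop :=
  finite_set (range g) /\ forall v, measurable (g @^-1` [set v]).

Definition strongly_measurable (V : normedModType R) (F : R -> V) : Prop :=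
  exists2 g : nat -> R -> V, (forall n, simple_map (g n)) &
    forall t, t \in `[0, 1] -> (fun n => g n t) @ \oo --> F t.

Definition in_Ls (V : normedModType R) (s : R) (F : R -> V) : Prop :=
  strongly_measurable F /\
  (\int[mu]_(t in `[0%R, 1%R]) (`|F t| `^ s)%R%:E < +oo)%E.

(* F is (a representative of) the sum of the series of the r_i x_i in
   L_s([0, 1], V). *)
Definition Ls_sum (V : normedModType R) (s : R) (x : nat -> V) (F : R -> V) :
    Prop :=
  in_Ls s F /\
  (fun N => \int[mu]_(t in `[0%R, 1%R])
     (`|\sum_(i < N) rademacher i t *: x i - F t| `^ s)%R%:E)%E @ \oo --> 0%E.

(* Any two L_2-sums agree almost everywhere, so the choice is immaterial. *)
Definition L2_sum (V : normedModType R) (x : nat -> V) : R -> V :=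
  xget (cst 0) [set F | Ls_sum 2 x F].

Definition Rad_norm (V : normedModType R) (x : nat -> V) : \bar R :=
  ((\int[mu]_(t in `[0%R, 1%R]) (`|L2_sum x t| ^+ 2)%R%:E) `^ (2^-1)%R)%E.

Definition Rad (V : normedModType R) : seq_space V :=
  SeqSpace [set x | forall s : R, 0 < s -> exists F, Ls_sum s x F]
           (@Rad_norm V).

Definition truncate (V : normedModType R) (N : nat) (x : nat -> V) : nat -> V :=
  fun n => if (n < N)%N then x n else 0.

Definition RAD_norm (V : normedModType R) (x : nat -> V) : \bar R :=
  ereal_sup (range (fun N => Rad_norm (truncate N x))).

Definition RAD (V : normedModType R) : seq_space V :=
  SeqSpace [set x | (RAD_norm x < +oo)%E] (@RAD_norm V).

End Spaces.

Section Cotype.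
Context {R : realType} {X E : normedModType R}.
Local Notation mu := (@lebesgue_measure R).

Definition cotype_constants (q : R) (f : X -> E) : set R :=
  [set K | 0 < K /\
    forall (N : nat) (lam : 'I_N -> R) (x y : 'I_N -> X),
      (\sum_(k < N) `|lam k| `^ q * `|f (x k) - f (y k)| `^ q) `^ q^-1 <=
      K * Num.sqrt (\int[mu]_(t in `[0%R, 1%R])
        `|\sum_(k < N) (lam k * rademacher k t) *: (x k - y k)| ^+ 2)].

Definition cotype_Lip0 (q : R) : set (X -> E) :=
  [set f | Lip0 f /\ cotype_constants q f !=set0].

Definition cotype_norm (q : R) (f : X -> E) : R := inf (cotype_constants q f).

End Cotype.

(* Main.v *)
(* Both [Rad X] and [RAD X] contain the truncated sequences, with the norm
   [|\sum_(i < N) r_i x_i|_2], and in both this quantity is at most the norm of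
   the whole sequence: partial Rademacher sums have nondecreasing L_2-norms,
   which tend to the norm of the sum. Hence for either space [hat f] is
   K-Lipschitz into [lq] iff the cotype inequality with all weights equal to 1
   holds with constant K. To recover arbitrary weights [l_k], fix [c > 0] and
   cut the segment from [y_k] to [x_k] into [m_k ~ c / |l_k|] pieces; on one of
   them, [x'_k - y'_k], the map [f] varies by at least [1 / m_k] times
   [|f x_k - f y_k|]. Since [x'_k - y'_k ~ (l_k / c) (x_k - y_k)], the
   unweighted inequality for these pieces yields the weighted one as
   [c] tends to infinity. *)
Require Import Defs.
From mathcomp Require Import all_boot all_order all_algebra.
From mathcomp Require Import all_classical all_reals all_analysis.
From mathcomp Require Import measurable_realfun.
From mathcomp Require Import ring lra.
Import Order.TTheory GRing.Theory Num.Theory.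
Import numFieldNormedType.Exports.
Local Open Scope classical_set_scope.
Local Open Scope ring_scope.

Set Implicit Arguments.
Unset Strict Implicit.
Unset Printing Implicit Defensive.

(** * Finitely valued and strongly measurable functions *)

Section SimpleMaps.
Context {R : realType}.

(* [simple_map], for an arbitrary codomain. *)
Definition finite_measurable (U : Type) (g : R -> U) : Prop :=
  finite_set (range g) /\ forall v, measurable (g @^-1` [set v]).

Lemma finite_measurable_preimage (U : Type) (g : R -> U) (B : set U) :
  finite_measurable g -> measurable (g @^-1` B).
Proof.
move=> [fg mg].
have -> : g @^-1` B = \bigcup_(v in range g `&` B) g @^-1` [set v].
  apply/seteqP; split => [t Bt|t [v [_ Bv] /= ->]] //.
  by exists (g t) => //; split => //; exists t.
apply: fin_bigcup_measurable => //.
by apply: sub_finite_set fg => v [].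
Qed.

Lemma finite_measurable_comp2 (U1 U2 W : Type) (op : U1 -> U2 -> W)
    (g : R -> U1) (h : R -> U2) :
  finite_measurable g -> finite_measurable h ->
  finite_measurable (fun t => op (g t) (h t)).
Proof.
move=> [fg mg] [fh mh]; split.
  apply: sub_finite_set (finite_image2 op fg fh) => _ [t _ <-].
  by exists (g t); [exists t|exists (h t) => //; exists t].
move=> w.
have -> : (fun t => op (g t) (h t)) @^-1` [set w] = \bigcup_(a in range g)
    (g @^-1` [set a] `&` h @^-1` [set b | op a b = w]).
  apply/seteqP; split => [t /= <-|t [a _ [/= -> //]]].
  by exists (g t); [exists t|].
apply: fin_bigcup_measurable => // a _; apply: measurableI => //.
exact: finite_measurable_preimage.
Qed.

Lemma finite_measurable_cst (U : Type) (a : U) :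
  finite_measurable (fun _ : R => a).
Proof.
split; first by apply: sub_finite_set (finite_set1 a) => _ [t _ <-].
move=> v; have [->|av] := pselect (a = v).
  by rewrite (_ : _ @^-1` _ = setT) //; apply/seteqP.
by rewrite (_ : _ @^-1` _ = set0) //; apply/seteqP; split.
Qed.

Lemma finite_measurable_comp (U W : Type) (op : U -> W) (g : R -> U) :
  finite_measurable g -> finite_measurable (op \o g).
Proof.
move=> mg.
exact: (finite_measurable_comp2 (fun=> op) (finite_measurable_cst tt) mg).
Qed.

Lemma finite_measurable_fun (g : R -> R) (D : set R) : measurable D ->
  finite_measurable g -> measurable_fun D g.
Proof.
move=> mD mg _ B mB; apply: measurableI => //.
exact: finite_measurable_preimage.
Qed.

(** The possible values are -1, 0 and 1, and each fibre is the preimage of a Borel set under a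
    continuous sine. *)
Lemma finite_measurable_rademacher i : finite_measurable (@rademacher R i).
Proof.
have ms : measurable_fun setT (fun t : R => sin (2 ^+ i.+1 * pi * t)).
  apply: continuous_measurable_fun => t.
  apply: (@continuous_comp _ _ _ ( *%R (2 ^+ i.+1 * pi)) sin).
    exact: mulrl_continuous.
  exact: continuous_sin.
split.
  apply: (@sub_finite_set _ _ [set -1; 0; 1]) => [_ [t _ <-] /=|].
    rewrite /rademacher; case: sgrP => _ ; by [left; right|right|left; left].
  by rewrite !finite_setU.
move=> v.
have m B : measurable B ->
    measurable [set t : R | B (sin (2 ^+ i.+1 * pi * t))].
  by move=> mB; rewrite -[X in measurable X]setTI; exact: ms.
have [->|v0] := eqVneq v 0.
  rewrite (_ : _ @^-1` _ = [set t | [set (0 : R)] (sin (2 ^+ i.+1 * pi * t))]).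
    exact: m.
  by apply/seteqP; split => t /= /eqP; rewrite ?/rademacher ?sgr_eq0 => /eqP //;
    rewrite /rademacher => ->; rewrite sgr0.
have [->|v1] := eqVneq v 1.
  rewrite (_ : _ @^-1` _ =
      [set t | `]0, +oo[%classic (sin (2 ^+ i.+1 * pi * t))]).
    by apply: m; exact: measurable_itv.
  apply/seteqP; split => t /=; rewrite in_itv/= andbT -sgr_cp0 => /eqP //.
have [->|vN1] := eqVneq v (-1).
  rewrite (_ : _ @^-1` _ =
      [set t | `]-oo, 0[%classic (sin (2 ^+ i.+1 * pi * t))]).
    by apply: m; exact: measurable_itv.
  apply/seteqP; split => t /=; rewrite in_itv/= -sgr_cp0 => /eqP //.
rewrite (_ : _ @^-1` _ = set0)//; apply/seteqP; split => // t /=.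
rewrite /rademacher => vE; move: v0 v1 vN1; rewrite -vE.
by case: sgrP; rewrite eqxx.
Qed.

Section Strong.
Context {V : normedModType R}.
Implicit Types (F G : R -> V).

Lemma simple_map_strong F : finite_measurable F -> strongly_measurable F.
Proof. by move=> mF; exists (fun=> F) => // t _; exact: cvg_cst. Qed.

Lemma strongly_measurableB F G :
  strongly_measurable F -> strongly_measurable G ->
  strongly_measurable (F \- G).
Proof.
move=> [f sf fF] [g sg gG]; exists (fun n t => f n t - g n t).
  move=> n.
  exact: (finite_measurable_comp2 (fun a b : V => a - b) (sf n) (sg n)).
by move=> t t01; apply: cvgB; [exact: fF|exact: gG].
Qed.

Lemma strongly_measurable_norm F : strongly_measurable F ->
  measurable_fun (`[0%R, 1%R] : set R) (fun t => `|F t|).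
Proof.
move=> [f sf fF].
apply: (@measurable_fun_cvg _ _ _ _ (fun n t => `|f n t|)) => [n|t t01].
  apply: finite_measurable_fun; first exact: measurable_itv.
  exact: (finite_measurable_comp (fun a : V => `|a|) (sf n)).
by apply: cvg_norm; apply: fF; rewrite inE in t01 *.
Qed.

End Strong.
End SimpleMaps.

(** * Partial Rademacher sums, square integrals and a Young-type inequality *)

Definition rsum {R : realType} {V : normedModType R} (x : nat -> V) (N : nat)
  (t : R) : V := \sum_(i < N) rademacher i t *: x i.

Definition sqint {R : realType} {V : normedModType R} (F : R -> V) : \bar R :=
  (\int[@lebesgue_measure R]_(t in `[0%R, 1%R]) (`|F t| ^+ 2)%R%:E)%E.

Section SquareIntegrals.
Context {R : realType}.
Local Notation mu := (@lebesgue_measure R).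
Local Notation I := `[0%R : R, 1%R]%classic.

Lemma sqint_ge0 (V : normedModType R) (F : R -> V) : (0 <= sqint F)%E.
Proof. by apply: integral_ge0 => t _; rewrite lee_fin exprn_ge0. Qed.

Lemma measurable_sqr_norm (V : normedModType R) (F : R -> V) :
  strongly_measurable F -> measurable_fun I (fun t => (`|F t| ^+ 2)%:E).
Proof.
move=> mF; apply/measurable_EFinP; apply: measurable_funX.
exact: strongly_measurable_norm.
Qed.

Lemma ler_sqrD_young (a b c e : R) : 0 <= a -> a <= b + c -> 0 < e ->
  a ^+ 2 <= (1 + e) * b ^+ 2 + (1 + e^-1) * c ^+ 2.
Proof.
move=> a0 abc e0.
apply: (@le_trans _ _ ((b + c) ^+ 2)).
  by rewrite ler_sqr// nnegrE (le_trans a0).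
rewrite -subr_ge0.
have -> : (1 + e) * b ^+ 2 + (1 + e^-1) * c ^+ 2 - (b + c) ^+ 2 =
    e^-1 * (e * b - c) ^+ 2 by field; rewrite gt_eqF.
by rewrite mulr_ge0// ?invr_ge0 ?(ltW e0)// sqr_ge0.
Qed.

(** This takes the place of Minkowski's inequality in L_2 and is sharp as [e] tends to 0. The
    codomains differ so that an error term may be a real constant. *)
Lemma sqint_young (U V W : normedModType R)
    (F : R -> U) (G : R -> V) (H : R -> W) (e : R) :
  strongly_measurable F -> strongly_measurable G -> strongly_measurable H ->
  (forall t, `|H t| <= `|F t| + `|G t|) -> 0 < e ->
  (sqint H <= (1 + e)%:E * sqint F + (1 + e^-1)%:E * sqint G)%E.
Proof.
move=> mF mG mH HFG e0.
have e1 : 0 <= 1 + e by rewrite addr_ge0// ltW.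
have e2 : 0 <= 1 + e^-1 by rewrite addr_ge0// invr_ge0 ltW.
have mI : measurable I by exact: measurable_itv.
have sqintZE (Z : normedModType R) (K : R -> Z) k :
    strongly_measurable K -> 0 <= k ->
    (k%:E * sqint K = \int[mu]_(t in I) (k%:E * (`|K t| ^+ 2)%:E))%E.
  move=> mK k0; rewrite /sqint ge0_integralZl//.
  exact: measurable_sqr_norm.
rewrite !sqintZE// -ge0_integralD//.
- apply: ge0_le_integral => //.
  + exact: measurable_sqr_norm.
  + apply: emeasurable_funD; apply: measurable_funeM;
      exact: measurable_sqr_norm.
  + move=> t _; rewrite -!EFinM -EFinD lee_fin.
    exact: ler_sqrD_young.
- by move=> t _; rewrite -EFinM lee_fin mulr_ge0// exprn_ge0.
- by apply: measurable_funeM; exact: measurable_sqr_norm.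
- by move=> t _; rewrite -EFinM lee_fin mulr_ge0// exprn_ge0.
- by apply: measurable_funeM; exact: measurable_sqr_norm.
Qed.

(** For fixed [e] the error term disappears as [n] grows, in spite of its factor [1 + e^-1]; only
    then does [e] tend to 0. *)
Lemma young_limit (A B : \bar R) (d : nat -> \bar R) :
  (0 <= A)%E -> (0 <= B)%E -> d @ \oo --> 0%E ->
  (forall (e : R), 0 < e ->
    \forall n \near \oo, (A <= (1 + e)%:E * B + (1 + e^-1)%:E * d n)%E) ->
  (A <= B)%E.
Proof.
move=> A0 B0 d0 AB.
have AeB e : 0 < e -> (A <= (1 + e)%:E * B)%E.
  move=> e0.
  have cv : ((1 + e)%:E * B + (1 + e^-1)%:E * d n)%E @[n --> \oo] -->
      ((1 + e)%:E * B + (1 + e^-1)%:E * 0)%E.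
    apply: cvgeD.
    - by rewrite mule0 fin_num_adde_defl.
    - exact: cvg_cst.
    - exact: cvgeZl.
  rewrite mule0 adde0 in cv.
  rewrite -(cvg_lim _ cv)//.
  apply: lime_ge; first by apply/cvg_ex; eexists; exact: cv.
  exact: AB.
apply/lee_mul01Pr => // r /andP[r0 r1].
(* It suffices that [r * A <= B] for [0 < r < 1], so [e] is chosen with [1 + e = r^-1]. *)
have e0 : 0 < r^-1 - 1 by rewrite subr_gt0 invf_gt1.
have := AeB _ e0; rewrite addrC subrK.
by rewrite -(@lee_pdivrMl _ r^-1) ?invr_gt0// invrK.
Qed.

End SquareIntegrals.

(** * Rademacher sums as dyadic step functions; monotonicity of their L_2-norms *)

Section Contraction.
Context {R : realType}.
Local Notation mu := (@lebesgue_measure R).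

Lemma sgr_sin_pi (m : nat) (t : R) : m%:R < t < m.+1%:R ->
  Num.sg (sin (pi * t)) = (-1) ^+ m.
Proof.
elim: m t => [|m IH] t /andP[mt tm].
  rewrite expr0; apply/gtr0_sg/sin_gt0_pi.
  have p0 := pi_gt0 R.
  by rewrite mulr_gt0//= gtr_pMr.
have -> : pi * t = pi * (t - 1) + pi by ring.
rewrite sinDpi sgrN IH ?exprS ?mulN1r//.
by rewrite -natr1 in mt; rewrite -natr1 in tm; apply/andP; split; lra.
Qed.

(** The sign of [rademacher i] alternates over the dyadic cells of length [2 ^- i.+1], and cell [l]
    of length [2 ^- n] lies in the one numbered [l %/ 2 ^ (n - i.+1)]. *)
Lemma rademacher_dyadic (n i l : nat) (t : R) : (i < n)%N ->
  l%:R / (2 ^ n)%:R < t < l.+1%:R / (2 ^ n)%:R ->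
  rademacher i t = (-1) ^+ (l %/ 2 ^ (n - i.+1)).
Proof.
move=> lin; set d := (2 ^ (n - i.+1))%N.
have d0 : (0 < d)%N by rewrite expn_gt0.
have -> : (2 ^ n = 2 ^ i.+1 * d)%N by rewrite -expnD subnKC.
have p0 : 0 < (2 ^ i.+1 * d)%:R :> R by rewrite ltr0n muln_gt0 expn_gt0.
rewrite ltr_pdivrMr// ltr_pdivlMr// natrM natrX => /andP[lt tl].
rewrite /rademacher.
have -> : 2 ^+ i.+1 * pi * t = pi * (2 ^+ i.+1 * t) by ring.
apply: sgr_sin_pi.
have E : 2 ^+ i.+1 * t * d%:R = t * (2 ^+ i.+1 * d%:R) by ring.
have dR : 0 < d%:R :> R by rewrite ltr0n.
rewrite -(ltr_pM2r dR) -(ltr_pM2r dR (2 ^+ i.+1 * t)) E.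
apply/andP; split.
  apply: (@le_lt_trans _ _ l%:R); last exact: lt.
  by rewrite -natrM ler_nat leq_trunc_div.
apply: (lt_le_trans tl).
by rewrite -natrM ler_nat ltn_ceil.
Qed.

(** Values at the grid points, a null set, are left free because Rademacher functions vanish at some
    of them. *)
Lemma integral_step (p : nat) (g : R -> R) (c : nat -> R) : (0 < p)%N ->
  measurable_fun setT g -> (forall t, 0 <= g t) ->
  (forall (l : nat) t, (l < p)%N -> l%:R / p%:R < t < l.+1%:R / p%:R ->
    g t = c l) ->
  (\int[mu]_(t in `[0%R, 1%R]) (g t)%:E)%E = ((\sum_(l < p) c l) / p%:R)%:E.
Proof.
move=> p0 mg g0 gc.
have pR : 0 < p%:R :> R by rewrite ltr0n.
have mgE (D : set R) : measurable_fun D (fun t => (g t)%:E).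
  by apply/measurable_EFinP; apply: measurable_funS mg.
rewrite -integral_itv_bndo_bndc//.
(* Half-open intervals starting at 0 allow an induction that adds one cell at a time. *)
suff H m : (m <= p)%N -> (\int[mu]_(t in `[0%R, (m%:R / p%:R)%R[) (g t)%:E)%E =
    ((\sum_(l < m) c l) / p%:R)%:E.
  by have := H p (leqnn p); rewrite divff ?gt_eqF.
elim: m => [_|m IH mp].
  by rewrite mul0r set_itvco0 integral_set0 big_ord0 mul0r.
have m1 : m%:R / p%:R < m.+1%:R / p%:R :> R.
  by rewrite ltr_pM2r ?invr_gt0// ltr_nat.
have m0 : 0 <= m%:R / p%:R :> R by rewrite divr_ge0.
rewrite (@itv_bndbnd_setU _ _ _ (BLeft (m%:R / p%:R))) ?bnd_simp ?(ltW m1)//.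
rewrite ge0_integral_setU//=; last 3 first.
  exact: mgE.
  by move=> t _; rewrite lee_fin.
  by rewrite disj_set2E; apply/eqP/seteqP; split => // t /= [];
    rewrite !in_itv/= => /andP[_ a] /andP[b _];
    move: (lt_le_trans a b); rewrite ltxx.
rewrite IH ?(ltnW mp)// integral_itv_bndoo//.
rewrite (@eq_integral _ _ _ _ _ (cst (c m)%:E)); last first.
  by move=> t; rewrite inE/= in_itv/= => tm; rewrite (gc m).
rewrite integral_cst//= lebesgue_measure_itv/= lte_fin m1.
rewrite -EFinB -EFinM -EFinD big_ord_recr/= mulrDl; congr (_ + _)%:E.
by rewrite -mulrBl -natrB// subSnn mul1r.
Qed.

Lemma finite_measurable_rsum (V : normedModType R) (x : nat -> V) N :
  finite_measurable (rsum x N).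
Proof.
elim: N => [|N IH].
  rewrite (_ : rsum x 0 = fun=> 0); first exact: finite_measurable_cst.
  by apply/funext => t; rewrite /rsum big_ord0.
rewrite (_ : rsum x N.+1 = fun t => rsum x N t + rademacher N t *: x N).
  exact: (finite_measurable_comp2 (fun (a : V) (b : R) => a + b *: x N) IH
    (finite_measurable_rademacher N)).
by apply/funext => t; rewrite /rsum big_ord_recr.
Qed.

Lemma big_ord_double (F : nat -> R) k :
  \sum_(l < k.*2) F l = \sum_(j < k) (F j.*2 + F j.*2.+1).
Proof.
elim: k => [|k IH]; first by rewrite !big_ord0.
by rewrite doubleS !big_ord_recr/= IH addrA.
Qed.

(* On the two halves of a dyadic interval of length [2 ^- N] the first [N]
   terms contribute the same [w] and the next one contributes [x] and [- x];
   conclude by convexity of [z |-> `|z| ^+ 2]. *)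
Lemma sqint_rsumS (V : normedModType R) (x : nat -> V) N :
  (sqint (rsum x N) <= sqint (rsum x N.+1))%E.
Proof.
(* [w M l] is the value of [rsum x M] on cell [l] of length [2 ^- N.+1]; this mesh serves both [N]
   and [N.+1]. *)
pose w M l := \sum_(i < M) (-1) ^+ (l %/ 2 ^ (N.+1 - i.+1)) *: x i : V.
have wE M : (M <= N.+1)%N -> sqint (rsum x M) =
    ((\sum_(l < 2 ^ N.+1) `|w M l| ^+ 2) / (2 ^ N.+1)%:R)%:E.
  move=> MN; rewrite /sqint.
  apply: (integral_step (c := fun l => `|w M l| ^+ 2)).
  - by rewrite expn_gt0.
  - apply: finite_measurable_fun => //.
    exact: (finite_measurable_comp (fun a : V => `|a| ^+ 2)
      (finite_measurable_rsum x M)).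
  - by move=> t; rewrite exprn_ge0.
  - move=> l t _ lt; congr (`| _ | ^+ 2); apply: eq_bigr => i _.
    by rewrite (rademacher_dyadic _ lt)// (leq_trans (ltn_ord i)).
rewrite !wE// lee_fin ler_pM2r ?invr_gt0 ?ltr0n ?expn_gt0//.
rewrite expnS mul2n.
have D M := big_ord_double (fun l => `|w M l| ^+ 2) (2 ^ N).
rewrite !D; apply: ler_sum => j _.
have wj (l : nat) : (l %/ 2 = j)%N -> w N l = w N j.*2.
  move=> lj; apply: eq_bigr => i _; congr ((-1) ^+ _ *: _).
  have -> : (N.+1 - i.+1 = (N - i.+1).+1)%N by rewrite subSn// ltn_ord.
  by rewrite expnS !divnMA lj -muln2 mulnK.
have wS l : w N.+1 l = w N l + (-1) ^+ l *: x N.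
  by rewrite /w big_ord_recr/= subnn divn1.
have j2 : (j.*2.+1 %/ 2 = j)%N by rewrite divn2 /= uphalf_double.
have se : (-1) ^+ j.*2 = 1 :> R by rewrite -signr_odd odd_double.
rewrite !wS (wj _ j2) (exprS _ j.*2) se mulr1 scaleN1r scale1r.
set a := w N _; set b := x N.
have t : `|a| *+ 2 <= `|a + b| + `|a - b|.
  rewrite -(normrMn a) (le_trans _ (ler_normD _ _))//.
  by rewrite addrACA subrr addr0 -mulr2n.
have a0 : 0 <= `|a| by [].
have h0 := sqr_ge0 (`|a + b| - `|a - b|).
have h1 : (`|a| *+ 2) ^+ 2 <= (`|a + b| + `|a - b|) ^+ 2.
  by rewrite ler_sqr// nnegrE// ?mulrn_wge0// addr_ge0.
(* With p and q the norms of [a + b] and [a - b], [h1] gives 4|a|^2 <= (p + q)^2, and [h0] gives (p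
   + q)^2 <= 2(p^2 + q^2). *)
by nra.
Qed.

Lemma sqint_rsum_le (V : normedModType R) (x : nat -> V) N M : (N <= M)%N ->
  (sqint (rsum x N) <= sqint (rsum x M))%E.
Proof.
move=> /subnK <-; elim: (M - N)%N => // k IH.
by rewrite addSn (le_trans IH)// sqint_rsumS.
Qed.

End Contraction.

(** * The norms of Rad and RAD in terms of partial sums *)

Section RademacherNorms.
Context {R : realType}.
Local Notation mu := (@lebesgue_measure R).
Local Notation I := `[0%R : R, 1%R]%classic.
Context {V : normedModType R}.
Implicit Types (x y : nat -> V) (F G : R -> V).

Lemma integral_bounded_lty (k : R -> R) (B : R) : measurable_fun setT k ->
  (forall t, 0 <= k t <= B) -> (\int[mu]_(t in I) (k t)%:E < +oo)%E.
Proof.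
move=> mk kB; apply: (@le_lt_trans _ _ (\int[mu]_(t in I) (cst B%:E t))%E).
  apply: ge0_le_integral => //.
  - by move=> t _; rewrite lee_fin; case/andP: (kB t).
  - by apply/measurable_EFinP; apply: measurable_funS mk.
  - by move=> t _; rewrite lee_fin; case/andP: (kB t).
rewrite integral_cst//= lebesgue_measure_itv/= lte_fin ltr01.
by rewrite -EFinB -EFinM ltry.
Qed.

Lemma norm_rsum_le x N t : `|rsum x N t| <= \sum_(i < N) `|x i|.
Proof.
rewrite (le_trans (ler_norm_sum _ _ _))// ler_sum// => i _.
rewrite normrZ ler_piMl// /rademacher normr_sg.
by case: (_ != 0).
Qed.

Lemma sqint_rsum_fin_num x N : sqint (rsum x N) \is a fin_num.
Proof.
rewrite ge0_fin_numE ?sqint_ge0//.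
apply: (@integral_bounded_lty _ ((\sum_(i < N) `|x i|) ^+ 2)).
  apply: finite_measurable_fun => //.
  exact: (finite_measurable_comp (fun a : V => `|a| ^+ 2)
    (finite_measurable_rsum x N)).
move=> t; rewrite exprn_ge0//= ler_sqr ?nnegrE ?norm_rsum_le//.
by rewrite sumr_ge0.
Qed.

Lemma rsum_strongly_measurable x N : strongly_measurable (rsum x N).
Proof. exact/simple_map_strong/finite_measurable_rsum. Qed.

Lemma rsum_truncate x N M : rsum (truncate N x) M = rsum x (minn N M).
Proof.
apply/funext => t; elim: M => [|M IH].
  by rewrite minn0 /rsum !big_ord0.
rewrite /rsum big_ord_recr/= -[X in X + _]/(rsum _ _ t) IH /truncate.
case: ltnP => NM.
  by rewrite (minn_idPr NM) /rsum big_ord_recr.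
by rewrite scaler0 addr0 (minn_idPl (leqW NM)).
Qed.

(** From rank [N] on, the partial sums equal [rsum x N], which is bounded and hence in every L_s. *)
Lemma Ls_sum_truncate (s : R) x N : 0 < s ->
  Ls_sum s (truncate N x) (rsum x N).
Proof.
move=> s0; split.
  split; first exact: rsum_strongly_measurable.
  apply: (@integral_bounded_lty _ ((\sum_(i < N) `|x i|) `^ s)).
    apply: finite_measurable_fun => //.
    exact: (finite_measurable_comp (fun a : V => `|a| `^ s)
      (finite_measurable_rsum x N)).
  move=> t; rewrite powR_ge0/= ge0_ler_powR ?(ltW s0)// ?nnegrE ?norm_rsum_le//.
  by rewrite sumr_ge0.
apply: cvg_near_cst; near=> M.
rewrite integral0_eq// => t _; rewrite -/(rsum _ _ t) rsum_truncate.
rewrite (minn_idPl _); last by near: M; exact: nbhs_infty_ge.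
by rewrite subrr normr0 powR0// gt_eqF.
Unshelve. all: by end_near. Qed.

Lemma integral_powR2 F :
  (\int[mu]_(t in I) (`|F t| `^ 2)%:E)%E = sqint F.
Proof. by apply: eq_integral => t _; rewrite -powR_mulrn. Qed.

Lemma Ls_sum2P x F : Ls_sum 2 x F <->
  [/\ strongly_measurable F, (sqint F < +oo)%E &
      sqint (rsum x N \- F)%R @[N --> \oo] --> 0%E].
Proof.
have E : (fun N => \int[mu]_(t in I)
      (`|\sum_(i < N) rademacher i t *: x i - F t| `^ 2)%R%:E)%E =
    (fun N => sqint (rsum x N \- F)%R).
  by apply/funext => N; exact: (integral_powR2 (rsum x N \- F)).
rewrite /Ls_sum /in_Ls integral_powR2 E.
by split => [[[]]|[]].
Qed.

(** Young's inequality with [e = 1] is enough: the factor 2 harms neither finiteness nor convergence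
    to 0. *)
Lemma Ls_sumB x y F G : Ls_sum 2 x F -> Ls_sum 2 y G ->
  Ls_sum 2 (x - y) (F \- G).
Proof.
move=> /Ls_sum2P[mF Foo cF] /Ls_sum2P[mG Goo cG]; apply/Ls_sum2P.
have e1 : (1 + 1 : R)%:E \is a fin_num by [].
split; first exact: strongly_measurableB.
  apply: (@le_lt_trans _ _ ((1 + 1)%:E * sqint F + (1 + 1^-1)%:E * sqint G)%E).
    apply: sqint_young => //; first exact: strongly_measurableB.
    by move=> t; exact: ler_normB.
  by rewrite lte_add_pinfty// lte_mul_pinfty// lee_fin.
have c0 : ((1 + 1)%:E * sqint (rsum x N \- F)%R +
    (1 + 1^-1)%:E * sqint (rsum y N \- G)%R)%E @[N --> \oo] --> 0%E.
  have -> : 0%E = ((1 + 1)%:E * 0 + (1 + 1^-1)%:E * 0)%E :> \bar R.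
    by rewrite !mule0 adde0.
  apply: cvgeD; [|exact: cvgeZl|exact: cvgeZl].
  by rewrite !mule0 fin_num_adde_defl.
apply: squeeze_cvge (cvg_cst 0%E) c0; apply: nearW => N.
rewrite sqint_ge0/= sqint_young//.
- by apply: strongly_measurableB => //; exact: rsum_strongly_measurable.
- by apply: strongly_measurableB => //; exact: rsum_strongly_measurable.
- apply: strongly_measurableB; first exact: rsum_strongly_measurable.
  exact: strongly_measurableB.
move=> t; rewrite /= (_ : _ - _ = rsum x N t - F t - (rsum y N t - G t)).
  exact: ler_normB.
rewrite (_ : rsum (x - y) N t = rsum x N t - rsum y N t).
  by rewrite !opprD addrACA.
by rewrite /rsum -sumrB; apply: eq_bigr => i _; rewrite -scalerBr.
Qed.

(** Monotonicity of the partial sums turns the L_2-limit into a supremum. The right-hand side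
    depends on [x] alone, so all L_2-sums of [x] have the same norm. *)
Lemma sqint_Ls_sum x F : Ls_sum 2 x F ->
  sqint F = ereal_sup (range (fun N => sqint (rsum x N))).
Proof.
move=> /Ls_sum2P[mF Foo cF].
have mS := rsum_strongly_measurable x.
have mB N : strongly_measurable (rsum x N \- F) by exact: strongly_measurableB.
have sup0 : (0 <= ereal_sup (range (fun N => sqint (rsum x N))))%E.
  apply: (@le_trans _ _ (sqint (rsum x 0))); first exact: sqint_ge0.
  by apply: ereal_sup_ubound; exists 0.
apply/eqP; rewrite eq_le; apply/andP; split.
  apply: (young_limit (d := fun N => sqint (rsum x N \- F)%R)) => //.
    exact: sqint_ge0.
  move=> e e0; near=> N.
  apply: (@le_trans _ _
      ((1 + e)%:E * sqint (rsum x N) +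
       (1 + e^-1)%:E * sqint (rsum x N \- F)%R)%E).
    apply: sqint_young => // t.
    by rewrite -{1}(subKr (rsum x N t) (F t)) ler_normB.
  rewrite leeD2r// lee_pmul2l//; last by rewrite lte_fin addr_gt0.
  by apply: ereal_sup_ubound; exists N.
apply: ge_ereal_sup => _ [M _ <-].
apply: (young_limit (d := fun N => sqint (rsum x N \- F)%R)) => //.
- exact: sqint_ge0.
- exact: sqint_ge0.
(* Compare the partial sum at [M] with a later one at [N], which is close to [F]. *)
- move=> e e0; near=> N; apply: (@le_trans _ _ (sqint (rsum x N))).
    by apply: sqint_rsum_le; near: N; exact: nbhs_infty_ge.
  apply: sqint_young => // t.
  by rewrite -{1}(subrK (F t) (rsum x N t)) addrC ler_normD.
Unshelve. all: by end_near. Qed.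

Lemma ge0_le_sqrte (a b : \bar R) : (0 <= a)%E -> (a <= b)%E ->
  (a `^ 2^-1 <= b `^ 2^-1)%E.
Proof.
move=> a0 ab; apply: gt0_ler_poweR => //;
  by rewrite in_itv/= leey andbT// (le_trans a0).
Qed.

Lemma Rad_norm_Ls_sum x F : Ls_sum 2 x F -> Rad_norm x = (sqint F `^ 2^-1)%E.
Proof.
move=> xF.
have xL : Ls_sum 2 x (L2_sum x).
  by apply: (@xgetPex _ (cst 0) [set F | Ls_sum 2 x F]); exists F.
by rewrite /Rad_norm -/(sqint (L2_sum x)) (sqint_Ls_sum xF) (sqint_Ls_sum xL).
Qed.

Lemma Rad_norm_truncate x N :
  Rad_norm (truncate N x) = (sqint (rsum x N) `^ 2^-1)%E.
Proof. exact/Rad_norm_Ls_sum/Ls_sum_truncate. Qed.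

Lemma sqint_rsum_le_Rad_norm x F N : Ls_sum 2 x F ->
  (sqint (rsum x N) `^ 2^-1 <= Rad_norm x)%E.
Proof.
move=> xF; rewrite (Rad_norm_Ls_sum xF) ge0_le_sqrte ?sqint_ge0//.
by rewrite (sqint_Ls_sum xF); apply: ereal_sup_ubound; exists N.
Qed.

Lemma RAD_norm_truncate x N :
  RAD_norm (truncate N x) = (sqint (rsum x N) `^ 2^-1)%E.
Proof.
apply/eqP; rewrite eq_le; apply/andP; split.
  apply: ge_ereal_sup => _ [M _ <-].
  rewrite Rad_norm_truncate rsum_truncate ge0_le_sqrte ?sqint_ge0//.
  by rewrite sqint_rsum_le// geq_minl.
apply: ereal_sup_ubound; exists N => //.
by rewrite Rad_norm_truncate rsum_truncate minnn.
Qed.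

Lemma sqint_rsum_le_RAD_norm x N :
  (sqint (rsum x N) `^ 2^-1 <= RAD_norm x)%E.
Proof.
by rewrite -Rad_norm_truncate; apply: ereal_sup_ubound; exists N.
Qed.

End RademacherNorms.

(** * Replacing a weighted pair of points by an unweighted one *)

Section WeightsFromUnweighted.
Context {R : realType} {X E : normedModType R}.
Local Notation mu := (@lebesgue_measure R).
Local Notation I := `[0%R : R, 1%R]%classic.
Implicit Types (f : X -> E).

Lemma sqintZ (V : normedModType R) (k : R) (F : R -> V) :
  strongly_measurable F ->
  sqint (fun t => k *: F t) = ((k ^+ 2)%:E * sqint F)%E.
Proof.
move=> mF; rewrite /sqint -ge0_integralZl//; last 2 first.
- exact: measurable_sqr_norm.
- by rewrite lee_fin sqr_ge0.
by apply: eq_integral => t _; rewrite normrZ exprMn real_normK ?num_real.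
Qed.

Lemma sqint_cst (V : normedModType R) (v : V) :
  sqint (fun _ : R => v) = (`|v| ^+ 2)%:E.
Proof.
rewrite /sqint -[LHS]/(\int[mu]_(t in I) cst (`|v| ^+ 2)%:E t)%E integral_cst//.
by rewrite /= lebesgue_measure_itv/= lte_fin ltr01 -EFinB -EFinM subr0 mulr1.
Qed.

(* Subdivide the segment from [y] to [x] into [m] equal pieces and keep the one
   on which [f] varies most. *)
Lemma steep_subsegment f (x y : X) (m : nat) : (0 < m)%N ->
  exists a b, a - b = m%:R^-1 *: (x - y) /\
    `|f x - f y| <= m%:R * `|f a - f b|.
Proof.
move=> m0.
have mR : 0 < m%:R :> R by rewrite ltr0n.
pose p (j : nat) := y + (j%:R / m%:R) *: (x - y).
have pS j : p j.+1 - p j = m%:R^-1 *: (x - y).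
  rewrite /p opprD addrACA subrr add0r -scalerBl -mulrBl -natrB//.
  by rewrite subSnn mul1r.
have tel : f x - f y = \sum_(0 <= j < m) (f (p j.+1) - f (p j)).
  rewrite telescope_sumr// /p mul0r scale0r addr0 divff ?gt_eqF// scale1r.
  by rewrite [y + _]addrC subrK.
have [[j ?]|H] := pselect
    (exists j, `|f x - f y| <= m%:R * `|f (p j.+1) - f (p j)|).
  by exists (p j.+1), (p j).
(* If all [m] pieces varied by less than a fraction [1 / m] of the total, the telescoping sum would
   fall short of it. *)
exfalso; suff : `|f x - f y| < `|f x - f y| by rewrite ltxx.
rewrite {1}tel (le_lt_trans (ler_norm_sum _ _ _))//.
rewrite (@lt_le_trans _ _ (\sum_(0 <= j < m) (`|f x - f y| / m%:R)))//.
  apply: ltr_sum_nat => // j _; rewrite ltr_pdivlMr// mulrC ltNge.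
  by apply/negP => jH; apply: H; exists j.
by rewrite sumr_const_nat subn0 -[_ / _ *+ _]mulr_natr divfK ?gt_eqF.
Qed.

(** All weights [l] are to yield nearly the same factor [c^-1]. Up to an error controlled by [l],
    the difference of the new pair is [c^-1 *: (l *: (x - y))]. *)
Lemma rescaled_pair f (x y : X) (l c : R) : 0 < c ->
  exists abt : X * X * R,
    [/\ abt.1.1 - abt.1.2 = abt.2 *: (l *: (x - y)),
        `|abt.2 - c^-1| <= `|l| / c ^+ 2 &
        `|l| * `|f x - f y| <= (c + `|l|) * `|f abt.1.1 - f abt.1.2|].
Proof.
move=> c0; have [->|l0] := eqVneq l 0.
  exists (0, 0, c^-1); split => /=.
  - by rewrite subrr scale0r scaler0.
  - by rewrite subrr !normr0 mul0r.
  - by rewrite normr0 mul0r subrr normr0 mulr0.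
have al0 : 0 < `|l| by rewrite normr_gt0.
have d0 : 0 <= c / `|l| by rewrite divr_ge0 ?ltW.
(* [m] is the least integer with [m * |l| > c], so [m * |l|] exceeds [c] by at most [|l|]. *)
pose m := (Num.truncn (c / `|l|)).+1.
have mR : 0 < m%:R :> R by rewrite ltr0n.
have /andP[ml lm] := truncn_itv d0.
have cm : c < m%:R * `|l| by rewrite -ltr_pdivrMr.
have mc : m%:R * `|l| <= c + `|l|.
  by rewrite -ler_pdivlMr// mulrDl divff ?gt_eqF// -natr1 lerD2r.
pose th := (m%:R * `|l|)^-1.
have p0 : 0 < m%:R * `|l| by rewrite mulr_gt0.
have thc : `|th - c^-1| <= `|l| / c ^+ 2.
  rewrite distrC ger0_norm ?subr_ge0 ?lef_pV2 ?posrE// ?(ltW cm)//.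
  have -> : c^-1 - th = (m%:R * `|l| - c) / (c * (m%:R * `|l|)).
    by rewrite /th; field; rewrite !gt_eqF.
  rewrite ler_pdivrMr ?mulr_gt0// mulrAC ler_pdivlMr ?exprn_gt0// expr2.
  apply: ler_pM; rewrite ?subr_ge0 ?(ltW cm) ?mulr_ge0 ?(ltW c0)//.
    by rewrite lerBlDl.
  by rewrite ler_pM2l// ltW.
have [a [b [ab fab]]] := @steep_subsegment f x y m isT.
have fabl : `|l| * `|f x - f y| <= (c + `|l|) * `|f a - f b|.
  apply: (@le_trans _ _ (`|l| * (m%:R * `|f a - f b|))).
    by rewrite ler_pM2l.
  by rewrite mulrA (mulrC `|l|) ler_wpM2r.
have tl : th * l = Num.sg l / m%:R.
  by rewrite /th {2}[l]numEsg; field; rewrite !gt_eqF.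
(* A negative [l] is absorbed by exchanging the endpoints. *)
have [lp|ln] := ltP 0 l.
  exists (a, b, th); split => //=.
  by rewrite scalerA tl gtr0_sg// div1r.
exists (b, a, th); split => //=; last by rewrite (distrC (f b)).
by rewrite scalerA tl ltr0_sg ?lt_neqAle ?l0// mulN1r scaleNr -ab opprB.
Qed.
End WeightsFromUnweighted.

(** * From the unweighted to the weighted cotype inequality *)

Section Weights.
Context {R : realType} {X E : normedModType R}.
Local Notation mu := (@lebesgue_measure R).
Implicit Types (f : X -> E) (q K : R).

(** Extension by zero, which makes [rsum] applicable to finite families. *)
Definition ord_ext (V : nmodType) N (z : 'I_N -> V) : nat -> V :=
  fun n => oapp z 0 (insub n).

Lemma ord_extE (V : nmodType) N (z : 'I_N -> V) (i : 'I_N) : ord_ext z i = z i.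
Proof. by rewrite /ord_ext valK. Qed.

Definition unweighted_cotype q f K := forall N (x y : nat -> X),
  (\sum_(k < N) `|f (x k) - f (y k)| `^ q) `^ q^-1 <=
  K * Num.sqrt (fine (sqint (rsum (x - y) N))).

Lemma cotype_rhsE N (lam : 'I_N -> R) (x y : 'I_N -> X) (u : nat -> X) :
  (forall k : 'I_N, u k = lam k *: (x k - y k)) ->
  \int[mu]_(t in `[0%R, 1%R])
     `|\sum_(k < N) (lam k * rademacher k t) *: (x k - y k)| ^+ 2 =
  fine (sqint (rsum u N)).
Proof.
move=> uE; rewrite /sqint /Rintegral; congr fine; apply: eq_integral => t _.
congr (`|_| ^+ 2)%:E; apply: eq_bigr => k _.
by rewrite uE scalerA mulrC.
Qed.

Lemma cotype_unweighted q f K :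
  cotype_constants q f K -> unweighted_cotype q f K.
Proof.
move=> [_ fK] N x y.
have := fK N (fun=> 1) (fun k => x k) (fun k => y k).
rewrite (@cotype_rhsE _ _ _ _ (x - y)); last by move=> k; rewrite scale1r.
by under eq_bigr do rewrite normr1 powR1 mul1r.
Qed.

Lemma cotype_weighted q f K : 0 < q -> 0 < K ->
  unweighted_cotype q f K -> cotype_constants q f K.
Proof.
move=> q0 K0 fK; split => // N lam x y.
have q'0 : 0 <= q^-1 by rewrite invr_ge0 ltW.
pose u := ord_ext (fun k => lam k *: (x k - y k)).
have uE (k : 'I_N) : u k = lam k *: (x k - y k) by rewrite /u ord_extE.
rewrite (cotype_rhsE uE).
pose L := \sum_(k < N) `|lam k|.
have L0 : 0 <= L by rewrite sumr_ge0.
have lamL k : `|lam k| <= L.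
  by rewrite /L (bigD1 k)//= lerDl sumr_ge0.
pose B := \sum_(k < N) `|u k|.
have B0 : 0 <= B by rewrite sumr_ge0.
set b := fine (sqint (rsum u N)).
have b0 : 0 <= b by rewrite fine_ge0// sqint_ge0.
set lhs := (X in X <= _).
(* [h c^-1] is the bound obtained at parameter [c]: the first factor is [(c + L) / c], and the root
   comes from Young's inequality with [e = c^-1]. At 0 it equals [K * Num.sqrt b], the bound
   sought. *)
pose h (i : R) : R := (1 + L * i) *
  (K * Num.sqrt ((1 + i) * b + (i ^+ 2 + i) * (L * B) ^+ 2)).
have lhsh n : lhs <= h (n.+1%:R^-1).
  set c : R := n.+1%:R.
  have c0 : 0 < c by rewrite ltr0n.
  have cL0 : 0 <= c + L by rewrite addr_ge0// ltW.
  have [/= abt abtP] := choice (fun k : 'I_N =>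
    rescaled_pair f (x k) (y k) (lam k) c0).
  pose a := ord_ext (fun k => (abt k).1.1).
  pose a' := ord_ext (fun k => (abt k).1.2).
  have -> : h c^-1 = (c + L) * (K * Num.sqrt ((1 + c^-1) * (c^-1 ^+ 2 * b) +
      (1 + c) * (L / c ^+ 2 * B) ^+ 2)).
    rewrite /h.
    have -> : (1 + c^-1) * (c^-1 ^+ 2 * b) + (1 + c) * (L / c ^+ 2 * B) ^+ 2 =
        (c^-1) ^+ 2 * ((1 + c^-1) * b + (c^-1 ^+ 2 + c^-1) * (L * B) ^+ 2).
      by field; rewrite gt_eqF.
    rewrite (sqrtrM _ (sqr_ge0 _)) sqrtr_sqr (ger0_norm (ltW _)) ?invr_gt0//.
    by field; rewrite gt_eqF.
  (* Bounding each [|lam k|] by [L] gives a common factor [c + L], which leaves the sum as the q-th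
     root of its q-th power. *)
  apply: (@le_trans _ _ ((c + L) *
      (\sum_(k < N) `|f (a k) - f (a' k)| `^ q) `^ q^-1)).
    have sum0 : 0 <= \sum_(k < N) `|f (a k) - f (a' k)| `^ q.
      by rewrite sumr_ge0// => k _; rewrite powR_ge0.
    rewrite -{1}(@powRr1 _ (c + L))// -(@divff _ q) ?gt_eqF// powRrM.
    rewrite -powRM ?powR_ge0// ge0_ler_powR// ?nnegrE.
    - by rewrite sumr_ge0// => k _; rewrite mulr_ge0// powR_ge0.
    - by rewrite mulr_ge0// powR_ge0.
    rewrite mulr_sumr ler_sum// => k _; rewrite -!powRM//.
    rewrite ge0_ler_powR ?(ltW q0) ?nnegrE ?mulr_ge0//.
    have [_ _ /le_trans->//] := abtP k.
    by rewrite /a /a' !ord_extE ler_wpM2r// lerD2l.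
  rewrite ler_wpM2l// (le_trans (fK _ _ _))// ler_wpM2l ?(ltW K0)//.
  rewrite ler_wsqrtr// -lee_fin fineK ?sqint_rsum_fin_num//.
  have mS v : strongly_measurable (@rsum _ X v N).
    exact: rsum_strongly_measurable.
  have mZ : strongly_measurable (fun t => c^-1 *: rsum u N t).
    apply: simple_map_strong.
    exact: (finite_measurable_comp (fun v : X => c^-1 *: v)
      (finite_measurable_rsum u N)).
  have d0 : 0 <= L / c ^+ 2 * B.
    by rewrite !mulr_ge0 ?invr_ge0 ?exprn_ge0 ?(ltW c0).
  (* The error enters as a constant of order [c ^- 2]. Even after the factor [1 + c], its square is
     of order [c ^- 3], against [c ^- 2] for the main term. *)
  suff : (sqint (rsum (a - a')%R N) <=
      (1 + c^-1)%:E * sqint (fun t => c^-1 *: rsum u N t)%R +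
      (1 + c^-1^-1)%:E * sqint (fun _ : R => (L / c ^+ 2 * B : R^o))%R)%E.
    rewrite sqintZ// sqint_cst ger0_norm// invrK.
    by rewrite -[sqint (rsum u N)]fineK ?sqint_rsum_fin_num.
  apply: sqint_young => //.
  - exact: (simple_map_strong (finite_measurable_cst _)).
  (* [w] is the deviation of the actual differences from [c^-1 *: u]; its Rademacher sum is bounded
     by the sum of the norms. *)
  - move=> t; pose w := a - a' - (fun k => c^-1 *: u k).
    have -> : rsum (a - a') N t = c^-1 *: rsum u N t + rsum w N t.
      rewrite /rsum scaler_sumr -big_split; apply: eq_bigr => k _ /=.
      rewrite scalerA (mulrC c^-1) -scalerA -scalerDr; congr (_ *: _).
      by rewrite -[w k]/((a - a') k - c^-1 *: u k) [RHS]addrC subrK.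
    rewrite (le_trans (ler_normD _ _))// lerD2l.
    rewrite (le_trans (norm_rsum_le _ _ _))// [leRHS]ger0_norm//.
    rewrite mulr_sumr ler_sum// => k _.
    have [abE abc _] := abtP k.
    have -> : w k = ((abt k).2 - c^-1) *: u k.
      rewrite -[w k]/(a k - a' k - c^-1 *: u k) /a /a' !ord_extE abE.
      by rewrite scalerBl uE.
    rewrite normrZ ler_wpM2r// (le_trans abc)// ler_pM2r ?invr_gt0 ?exprn_gt0//.
  - by rewrite invr_gt0.
have ch : h (n.+1%:R^-1) @[n --> \oo] --> h 0.
  have i0 : (n.+1%:R^-1 : R) @[n --> \oo] --> (0 : R) by exact: cvg_harmonic.
  apply: cvgM.
    by apply: cvgD; [exact: cvg_cst|apply: cvgM => //; exact: cvg_cst].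
  apply: cvgM; first exact: cvg_cst.
  apply: (continuous_cvg _ (@sqrt_continuous R _)).
  apply: cvgD; apply: cvgM; try exact: cvg_cst.
    by apply: cvgD => //; exact: cvg_cst.
  apply: cvgD => //; rewrite expr2; under eq_fun do rewrite expr2.
  exact: cvgM.
have : lhs <= h 0.
  rewrite -(cvg_lim _ ch)//; apply: limr_ge.
    by apply/cvg_ex; exists (h 0).
  exact: nearW.
by rewrite /h mulr0 !addr0 !mul1r expr0n/= mul0r addr0.
Qed.
End Weights.

(** * The norm of l_q through finite sections *)

Section LqNorm.
Context {R : realType} {E : normedModType R}.
Implicit Types (q : R) (z : nat -> E).

Lemma lq_norm_ge_partial q z N : 0 < q ->
  (((\sum_(k < N) `|z k| `^ q) `^ q^-1)%:E <= lq_norm q z)%E.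
Proof.
move=> q0; rewrite -poweR_EFin /lq_norm.
have p0 i : (0 <= (`|z i| `^ q)%:E)%E by rewrite lee_fin powR_ge0.
apply: gt0_ler_poweR.
- by rewrite invr_ge0 ltW.
- by rewrite in_itv/= leey andbT lee_fin sumr_ge0// => k _; rewrite powR_ge0.
- by rewrite in_itv/= leey andbT nneseries_ge0.
rewrite -sumEFin -(big_mkord xpredT (fun i => (`|z i| `^ q)%:E)).
exact: nneseries_lim_ge.
Qed.

Lemma lq_norm_le_partial q z (M : \bar R) : 0 < q ->
  (forall N, ((\sum_(k < N) `|z k| `^ q) `^ q^-1)%:E <= M)%E ->
  (lq_norm q z <= M)%E.
Proof.
move=> q0 zM.
have q'0 : 0 <= q^-1 by rewrite invr_ge0 ltW.
have p0 i : (0 <= (`|z i| `^ q)%:E)%E by rewrite lee_fin powR_ge0.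
have M0 : (0 <= M)%E by apply: le_trans (zM 0%N); rewrite lee_fin powR_ge0.
(* Writing [M] as the q-th root of its q-th power leaves a bound on the series itself, to be checked
   on its partial sums. *)
rewrite -[M]poweRe1// -(@divff _ q) ?gt_eqF// poweRrM.
apply: gt0_ler_poweR => //.
- by rewrite in_itv/= leey andbT nneseries_ge0.
- by rewrite in_itv/= leey andbT poweR_ge0.
apply: lime_le; first exact: is_cvg_nneseries.
apply: nearW => N; rewrite big_mkord sumEFin.
set s := \sum_(i < N) _.
have s0 : 0 <= s by rewrite sumr_ge0// => i _; rewrite powR_ge0.
rewrite -[s]powRr1// -(@mulVf _ q) ?gt_eqF// powRrM -poweR_EFin.
apply: gt0_ler_poweR; rewrite ?(ltW q0)//.
- by rewrite in_itv/= leey andbT lee_fin powR_ge0.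
- by rewrite in_itv/= leey andbT.
exact: zM.
Qed.

Lemma lq_norm_ge0 q z : (0 <= lq_norm q z)%E.
Proof. exact: poweR_ge0. Qed.

Lemma lq_norm0 q : 0 < q -> lq_norm q (0 : nat -> E) = 0%E.
Proof.
move=> q0; apply/eqP; rewrite eq_le lq_norm_ge0 andbT.
apply: lq_norm_le_partial => // N.
rewrite big1 ?powR0 ?invr_eq0 ?gt_eqF// => i _.
by rewrite normr0 powR0// gt_eqF.
Qed.

End LqNorm.

(** * The equivalence and the equality of constants for an abstract sequence space *)

Section Equivalence.
Context {R : realType} {X E : normedModType R}.

Lemma sqrte_sqint_rsum (x : nat -> X) N :
  (sqint (rsum x N) `^ 2^-1)%E = (Num.sqrt (fine (sqint (rsum x N))))%:E.
Proof.
rewrite -{1}[sqint _]fineK ?sqint_rsum_fin_num// poweR_EFin powR12_sqrt//.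
by rewrite fine_ge0// sqint_ge0.
Qed.

Lemma truncateB N (x y : nat -> X) :
  truncate N x - truncate N y = truncate N (x - y).
Proof.
apply/funext => n; rewrite -[LHS]/(truncate N x n - truncate N y n) /truncate.
by case: ifP => // _; rewrite subr0.
Qed.

(** [A] stands for both [RAD X] and [Rad X]. The lower bound concerns differences of elements
    because for [Rad X] it rests on an L_2-sum of [x - y], built from those of [x] and [y]. *)
Context (q : R) (f : X -> E) (A : seq_space X) (q0 : 0 < q) (f0 : Lip0 f)
  (A_truncate : forall N x, seq_in A (truncate N x))
  (A_norm_truncate : forall N x,
    seq_norm A (truncate N x) = (sqint (rsum x N) `^ 2^-1)%E)
  (A_norm_ge : forall x y, seq_in A x -> seq_in A y ->
    forall N, (sqint (rsum (x - y)%R N) `^ 2^-1 <= seq_norm A (x - y)%R)%E)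
  (A_norm_lty : forall x, seq_in A x -> (seq_norm A x < +oo)%E).

Lemma seq_in0 : seq_in A 0.
Proof. exact: (A_truncate 0 0). Qed.

Lemma hat0 : hat f 0 = 0.
Proof. by apply/funext => n; case: f0. Qed.

Lemma lq_norm_hat_le K x y : cotype_constants q f K ->
  seq_in A x -> seq_in A y ->
  (lq_norm q (hat f x - hat f y)%R <= K%:E * seq_norm A (x - y)%R)%E.
Proof.
move=> fK Ax Ay; apply: lq_norm_le_partial => // N.
have := cotype_unweighted fK N x y; rewrite -lee_fin => /le_trans; apply.
rewrite EFinM -sqrte_sqint_rsum; apply: lee_wpmul2l; last exact: A_norm_ge.
by rewrite lee_fin ltW//; case: fK.
Qed.

(** Asking for the bound on truncations only lets [K] be either a given Lipschitz constant or a
    perturbed supremum of quotients. *)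
Lemma unweighted_cotype_hat K :
  (forall N x y, lq_norm q (hat f (truncate N x) - hat f (truncate N y))%R <=
    K%:E * seq_norm A (truncate N x - truncate N y)%R)%E ->
  unweighted_cotype q f K.
Proof.
move=> fK N x y; rewrite -lee_fin EFinM -sqrte_sqint_rsum -A_norm_truncate.
rewrite -truncateB (le_trans _ (fK _ _ _))//.
apply: le_trans (lq_norm_ge_partial _ N q0); rewrite le_eqVlt; apply/orP; left.
apply/eqP; congr ((_ `^ _)%:E); apply: eq_bigr => k _.
by congr (`|_| `^ _); rewrite -[RHS]/(f _ - f _) /truncate ltn_ord.
Qed.

Lemma cotype_Lip0_hat : cotype_Lip0 q f <-> seq_Lip0 A (lq E q) (hat f).
Proof.
split=> [[_ [K fK]]|[_ _ [K K0 fK]]]; last first.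
  (* A Lipschitz constant may be 0, whereas cotype constants are positive. *)
  split => //; exists (K + 1); apply: cotype_weighted => //.
    by rewrite ltr_wpDl.
  apply: unweighted_cotype_hat => N x y; apply: le_trans (fK _ _ _ _) _ => //.
  by rewrite truncateB A_norm_truncate lee_wpmul2r ?poweR_ge0// lee_fin lerDl.
have K0 : 0 <= K by rewrite ltW//; case: fK.
split; [move=> x Ax /=|exact: hat0|exists K => // x y].
  have := lq_norm_hat_le fK Ax seq_in0.
  rewrite hat0 !subr0 => /le_lt_trans; apply.
  by rewrite lte_mul_pinfty// A_norm_lty.
exact: lq_norm_hat_le.
Qed.

(** Every cotype constant bounds the quotients, so the supremum is at most the infimum. Conversely,
    for every [e > 0], [sup S + e] is a Lipschitz constant on truncations, hence a cotype
    constant. *)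
Lemma seq_Lip_hat : cotype_Lip0 q f ->
  seq_Lip A (lq E q) (hat f) = cotype_norm q f.
Proof.
move=> [_ [K fK]]; rewrite /seq_Lip /cotype_norm.
set S := [set r | _]; set C := cotype_constants q f.
have A_norm_ge0 x y : seq_in A x -> seq_in A y -> (0 <= seq_norm A (x - y)%R)%E.
  by move=> Ax Ay; apply: le_trans (A_norm_ge Ax Ay 0); rewrite poweR_ge0.
have SC M : C M -> ubound S M.
  move=> CM _ [x [y [Ax Ay _ ->]]].
  have M0 : 0 <= M by rewrite ltW//; case: CM.
  have := lq_norm_hat_le CM Ax Ay; have := A_norm_ge0 _ _ Ax Ay.
  have /= := lq_norm_ge0 q (hat f x - hat f y).
  (* An infinite denominator has [fine] equal to 0, and the quotient is then 0. *)
  move: (lq_norm _ _) (seq_norm _ _) => a [b| |]// a0; last first.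
    by move=> _ _; rewrite invr0 mulr0.
  rewrite lee_fin => b_ge0 ab.
  have [->|bn0] := eqVneq b 0; first by rewrite invr0 mulr0.
  have b0 : 0 < b by rewrite lt_neqAle eq_sym bn0.
  rewrite ler_pdivrMr// -lee_fin EFinM fineK// ge0_fin_numE//.
  by rewrite (le_lt_trans ab)// -EFinM ltry.
have supS0 : 0 <= sup S.
  (* [S] may be empty, and the supremum is then 0 by convention. *)
  have [[r Sr]|/nonemptyPn ->] := pselect (S !=set0); last by rewrite sup0.
  have r0 : 0 <= r.
    case: Sr => x [y [Ax Ay _ ->]].
    by rewrite divr_ge0 ?fine_ge0 ?lq_norm_ge0 ?A_norm_ge0.
  by rewrite (le_trans r0)// ub_le_sup//; exists K; exact: SC.
apply/eqP; rewrite eq_le; apply/andP; split.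
  apply: lb_le_inf; first by exists K.
  move=> M CM.
  have [Sn0|/nonemptyPn ->] := pselect (S !=set0); first exact/ge_sup/SC.
  by rewrite sup0 ltW//; case: CM.
apply/ler_addgt0Pr => e e0; apply: ge_inf.
  by exists 0 => M [/ltW].
apply: cotype_weighted => //; first by rewrite ltr_wpDl.
apply: unweighted_cotype_hat => N x y.
set x' := truncate N x; set y' := truncate N y.
have Ax : seq_in A x' by exact: A_truncate.
have Ay : seq_in A y' by exact: A_truncate.
have [->|xy] := pselect (x' = y').
  by rewrite subrr lq_norm0// mule_ge0 ?A_norm_ge0// lee_fin addr_ge0// ltW.
have : sup S >=
    fine (lq_norm q (hat f x' - hat f y')) / fine (seq_norm A (x' - y')).
  by apply: ub_le_sup; [exists K; exact: SC|exists x', y'].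
have := lq_norm_hat_le fK Ax Ay; have := A_norm_ge0 _ _ Ax Ay.
have := lq_norm_ge0 q (hat f x' - hat f y').
have : (seq_norm A (x' - y')%R < +oo)%E.
  by rewrite truncateB A_norm_lty.
move: (lq_norm _ _) (seq_norm _ _) => a [b| |]// _ a0.
rewrite lee_fin => b_ge0 ab.
(* At [b = 0] the quotient is 0 by convention and says nothing; the bound [ab] with the constant [K]
   forces [a] to vanish. *)
have [b0|bn0] := eqVneq b 0.
  by move=> _; move: ab; rewrite b0 !mule0.
have b0 : 0 < b by rewrite lt_neqAle eq_sym bn0.
rewrite ler_pdivrMr// => asb.
have af : a \is a fin_num.
  by rewrite ge0_fin_numE// (le_lt_trans ab)// -EFinM ltry.
rewrite -(fineK af) -EFinM lee_fin (le_trans asb)//.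
by rewrite ler_wpM2r ?(ltW b0)// lerDl ltW.
Qed.

End Equivalence.

(** * RAD and Rad as instances of the abstract equivalence *)

Theorem corollary3p6 (R : realType) (q : R) (hq : 2 <= q)
    (X E : completeNormedModType R) (f : X -> E) (hf : Lip0 f) :
  [/\ cotype_Lip0 q f <-> seq_Lip0 (RAD X) (lq E q) (hat f),
      seq_Lip0 (RAD X) (lq E q) (hat f) <-> seq_Lip0 (Rad X) (lq E q) (hat f) &
      cotype_Lip0 q f ->
        seq_Lip (RAD X) (lq E q) (hat f) = seq_Lip (Rad X) (lq E q) (hat f) /\
        seq_Lip (Rad X) (lq E q) (hat f) = cotype_norm q f].
Proof.
have q0 : 0 < q by apply: lt_le_trans hq.
have sqrt_lty (a : \bar R) : (a < +oo)%E -> (a `^ 2^-1 < +oo)%E.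
  exact: poweR_lty.
have RAD_in N x : seq_in (RAD X) (truncate N x).
  rewrite /= RAD_norm_truncate sqrt_lty//.
  by rewrite -ge0_fin_numE ?sqint_ge0// sqint_rsum_fin_num.
have RAD_ge (x y : nat -> X) : seq_in (RAD X) x -> seq_in (RAD X) y ->
    forall N,
      (sqint (rsum (x - y)%R N) `^ 2^-1 <= seq_norm (RAD X) (x - y)%R)%E.
  by move=> _ _ N; exact: sqint_rsum_le_RAD_norm.
have RAD_lty (x : nat -> X) : seq_in (RAD X) x -> (seq_norm (RAD X) x < +oo)%E.
  by [].
have RAD_norm N x := RAD_norm_truncate (V := X) x N.
have Rad_in N x : seq_in (Rad X) (truncate N x).
  by move=> s s0; exists (rsum x N); exact: Ls_sum_truncate.
have Rad_ge (x y : nat -> X) : seq_in (Rad X) x -> seq_in (Rad X) y ->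
    forall N,
      (sqint (rsum (x - y)%R N) `^ 2^-1 <= seq_norm (Rad X) (x - y)%R)%E.
  (* Only the exponent [s = 2] of membership in [Rad X] enters the norm. *)
  move=> /(_ 2 (ltr0n _ _))[F xF] /(_ 2 (ltr0n _ _))[G yG] N.
  exact: (sqint_rsum_le_Rad_norm _ (Ls_sumB xF yG)).
have Rad_lty (x : nat -> X) : seq_in (Rad X) x -> (seq_norm (Rad X) x < +oo)%E.
  move=> /(_ 2 (ltr0n _ _))[F xF] /=.
  by rewrite (Rad_norm_Ls_sum xF) sqrt_lty//; case/Ls_sum2P: xF.
have Rad_norm N x := Rad_norm_truncate (V := X) x N.
have RAD_iff := cotype_Lip0_hat q0 hf RAD_in RAD_norm RAD_ge RAD_lty.
have Rad_iff := cotype_Lip0_hat q0 hf Rad_in Rad_norm Rad_ge Rad_lty.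
split => // [|fq]; first by rewrite -RAD_iff.
rewrite (seq_Lip_hat q0 RAD_in RAD_norm RAD_ge RAD_lty)//.
by rewrite (seq_Lip_hat q0 Rad_in Rad_norm Rad_ge Rad_lty).
Qed.
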